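(* Let $\mathcal{R}_n$ be the $n$-dimensional complex filiform Lie algebra with basis $\{e_1,\dots,e_n\}$ and brackets $$[e_1,e_i]=-[e_i,e_1]=e_{i+1},\quad 2\le i\le n-1,\qquad [e_2,e_i]=-[e_i,e_2]=e_{i+2},\quad 3\le i\le n-2,$$ all other brackets of basis elements being zero. Then a minimal faithful representation of $\mathcal{R}_n$ is given by the linear map $\psi:\mathcal{R}_n\to\mathfrak{gl}(n,\mathbb{C})$, $$a_1e_1+a_2e_2+\dots+a_{n}e_{n}\mapsto\begin{pmatrix} 0&a_1&a_2&0&\dots&0&0&0&a_{n}\\ 0&0&a_1&a_2&\dots&0&0&0&a_{n-1}\\ 0&0&0&a_1&\dots&0&0&0&a_{n-2}\\ 0&0&0&0&\dots&0&0&0&a_{n-3}\\ \vdots&\vdots&\vdots&\vdots&\ddots&\vdots&\vdots&\vdots&\vdots\\ 0&0&0&0&\dots&0&a_1&a_2&a_4\\ 0&0&0&0&\dots&0&0&a_1&a_3\\ 0&0&0&0&\dots&0&0&0&a_2\\ 0&0&0&0&\dots&0&0&0&0 \end{pmatrix},$$ that is, $\psi(e_1)=\sum_{i=1}^{n-2}E_{i,i+1}$, $\psi(e_2)=\sum_{i=1}^{n-3}E_{i,i+2}+E_{n-1,n}$, and $\psi(e_i)=E_{n+1-i,n}$ for $3\le i\le n$.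
   Context: All Lie algebras and representations are finite-dimensional over $\mathbb{C}$. $\mathfrak{gl}(m,\mathbb{C})$ is the Lie algebra of complex $m\times m$ matrices with bracket $[A,B]=AB-BA$, and $E_{i,j}$ is the matrix whose $(i,j)$ entry is $1$ and whose other entries are $0$. Empty sums are zero. A representation of dimension $m$ of a Lie algebra $\mathfrak{g}$ is a Lie algebra homomorphism $\mathfrak{g}\to\mathfrak{gl}(m,\mathbb{C})$; it is faithful if it is injective. Set $\mu(\mathfrak{g})=\min\{\dim M \mid M \text{ is a faithful } \mathfrak{g}\text{-module}\}$; a faithful representation is called minimal if its dimension equals $\mu(\mathfrak{g})$. A Lie algebra $L$ of dimension $m$ is filiform if $\dim L^i=m-i$ for $2\le i\le m$, where $L^1=L$ and $L^{k+1}=[L,L^k]$. *)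

(* Defs.v *)
From HB Require Import structures.
From mathcomp Require Import all_boot all_order all_algebra.
From mathcomp Require Import ring zify.
From mathcomp Require Import all_classical reals.

Set Implicit Arguments.
Unset Strict Implicit.
Unset Printing Implicit Defensive.

Import GRing.Theory.
Local Open Scope ring_scope.

HB.mixin Record isLieAlgebra (F : fieldType) L of Vector F L := {
  lie : L -> L -> L;
  lie_linearl : forall y, linear (lie^~ y);
  lie_linearr : forall x, linear (lie x);
  liexx : forall x, lie x x = 0;
  lie_jacobi : forall x y z,
    lie x (lie y z) + lie y (lie z x) + lie z (lie x y) = 0
}.

#[short(type="lieAlgType")]
HB.structure Definition LieAlgebra (F : fieldType) :=
  { L of isLieAlgebra F L & Vector F L }.

Section Gl.
Variables (F : fieldType) (m : nat).

Definition gl : Type := 'M[F]_m.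
HB.instance Definition _ := Vector.on gl.

Definition gl_lie (A B : gl) : gl := A *m B - B *m A.

Lemma gl_lie_linearl B : linear (gl_lie^~ B).
Proof.
move=> a A A'; rewrite /gl_lie mulmxDl mulmxDr -scalemxAl -scalemxAr.
by rewrite scalerBr opprD addrACA.
Qed.

Lemma gl_lie_linearr A : linear (gl_lie A).
Proof.
move=> a B B'; rewrite /gl_lie mulmxDl mulmxDr -scalemxAl -scalemxAr.
by rewrite scalerBr opprD addrACA.
Qed.

Lemma gl_liexx A : gl_lie A A = 0.
Proof. exact: subrr. Qed.

Lemma gl_lie_jacobi A B C :
  gl_lie A (gl_lie B C) + gl_lie B (gl_lie C A) + gl_lie C (gl_lie A B) = 0.
Proof.
rewrite /gl_lie !(mulmxBl, mulmxBr) !mulmxA.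
set x1 := A *m B *m C; set x2 := A *m C *m B; set x3 := B *m C *m A.
set x4 := C *m B *m A; set x5 := B *m A *m C; set x6 := C *m A *m B.
by apply/matrixP => i j; rewrite !mxE; ring.
Qed.

HB.instance Definition _ := isLieAlgebra.Build F gl
  gl_lie_linearl gl_lie_linearr gl_liexx gl_lie_jacobi.

End Gl.

Section Representations.
Variables (F : fieldType) (L : lieAlgType F).

Definition lie_morphism (M : lieAlgType F) (f : L -> M) : Prop :=
  linear f /\ forall x y, f (lie x y) = lie (f x) (f y).

Definition representation (m : nat) (rho : L -> gl F m) : Prop :=
  lie_morphism rho.

Definition faithful_representation (m : nat) (rho : L -> gl F m) : Prop :=
  representation rho /\ injective rho.

Definition faithful_dim (m : nat) : Prop :=
  exists rho : L -> gl F m, faithful_representation rho.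

(* The default value 0 of [xget] is irrelevant as soon as [L] has a
   finite-dimensional faithful representation (always, by Ado's theorem, in
   characteristic 0). *)
Definition mu : nat :=
  xget 0%N (fun m => faithful_dim m /\
                     forall k, faithful_dim k -> (m <= k)%N).

Definition minimal_faithful_representation (m : nat) (rho : L -> gl F m) :
  Prop := faithful_representation rho /\ m = mu.

(* [U, V], the span of all brackets; see [lie_prodvP]. *)
Definition lie_prodv (U V : {vspace L}) : {vspace L} :=
  <<[seq lie u v | u <- vbasis U, v <- vbasis V]>>%VS.

(* L^k, numbered from L^1 = L. *)
Definition lower_central (k : nat) : {vspace L} :=
  iter k.-1 (lie_prodv fullv) fullv.

Definition filiform : Prop :=
  forall i, (2 <= i <= \dim {:L})%N -> \dim (lower_central i) = (\dim {:L} - i)%N.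

Lemma lie_suml I (r : seq I) (a : I -> F) (f : I -> L) y :
  lie (\sum_(i <- r) a i *: f i) y = \sum_(i <- r) a i *: lie (f i) y.
Proof.
have lin0 : lie (0 : L) y = 0.
  have := lie_linearl y (-1) 0 0.
  by rewrite scaler0 addr0 scaleN1r addNr.
by elim/big_rec2: _ => [//|i u v _ <-]; apply: lie_linearl.
Qed.

Lemma lie_sumr I (r : seq I) (a : I -> F) (f : I -> L) x :
  lie x (\sum_(i <- r) a i *: f i) = \sum_(i <- r) a i *: lie x (f i).
Proof.
have lin0 : lie x (0 : L) = 0.
  have := lie_linearr x (-1) 0 0.
  by rewrite scaler0 addr0 scaleN1r addNr.
by elim/big_rec2: _ => [//|i u v _ <-]; apply: lie_linearr.
Qed.

Lemma lie_prodvP (U V W : {vspace L}) :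
  (forall u v, u \in U -> v \in V -> lie u v \in W) <-> (lie_prodv U V <= W)%VS.
Proof.
split=> [UVW | sUVW u v Uu Vv].
  apply/span_subvP => _ /allpairsP[[u v] /= [Uu Vv ->]].
  by apply: UVW; apply: vbasis_mem.
apply: (subvP sUVW).
rewrite (coord_vbasis Uu) (coord_vbasis Vv) lie_suml rpred_sum // => i _.
rewrite memvZ // lie_sumr rpred_sum // => j _.
rewrite memvZ // memv_span //; apply/allpairsP.
by exists ((vbasis U)`_i, (vbasis V)`_j); split; rewrite ?mem_nth ?size_tuple.
Qed.

End Representations.

Section AlgebraR.
Variables (F : fieldType) (n : nat).

Definition Rn : Type := 'rV[F]_n.
HB.instance Definition _ := Vector.on Rn.

(* Indices of basis vectors and of matrix units are 1-based; an index outside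
   1..n gives 0. *)
Definition Rn_e (i : nat) : Rn := \row_(k < n) (k.+1 == i)%:R.

Definition Rn_table (i j : nat) : Rn :=
  if (i == 1%N) && (2 <= j <= n - 1)%N then Rn_e (j + 1)
  else if (j == 1%N) && (2 <= i <= n - 1)%N then - Rn_e (i + 1)
  else if (i == 2%N) && (3 <= j <= n - 2)%N then Rn_e (j + 2)
  else if (j == 2%N) && (3 <= i <= n - 2)%N then - Rn_e (i + 2)
  else 0.

Definition Rn_lie (x y : Rn) : Rn :=
  \sum_(i < n) \sum_(j < n) (x 0 i * y 0 j) *: Rn_table i.+1 j.+1.

Lemma Rn_lie_linearl y : linear (Rn_lie^~ y).
Proof.
move=> a x x'; rewrite /Rn_lie scaler_sumr -big_split; apply: eq_bigr => i _.
rewrite scaler_sumr -big_split; apply: eq_bigr => j _ /=.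
by rewrite !mxE scalerA mulrDl scalerDl mulrA.
Qed.

Lemma Rn_lie_linearr x : linear (Rn_lie x).
Proof.
move=> a y y'; rewrite /Rn_lie scaler_sumr -big_split; apply: eq_bigr => i _.
rewrite scaler_sumr -big_split; apply: eq_bigr => j _ /=.
by rewrite !mxE scalerA mulrDr scalerDl mulrCA.
Qed.

Lemma Rn_lie_e i j : (1 <= i <= n)%N -> (1 <= j <= n)%N ->
  Rn_lie (Rn_e i) (Rn_e j) = Rn_table i j.
Proof.
case: i j => [|i] [|j] //= lt_in lt_jn.
rewrite /Rn_lie (bigD1 (Ordinal lt_in)) //= (bigD1 (Ordinal lt_jn)) //=.
rewrite !mxE !eqxx mulr1 scale1r big1 => [|k]; last first.
  by rewrite -val_eqE !mxE eqSS /= => /negPf->; rewrite mulr0 scale0r.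
rewrite big1 ?addr0 // => k; rewrite -val_eqE /= => /negPf nki.
by rewrite big1 // => l _; rewrite !mxE eqSS nki mul0r scale0r.
Qed.

(* 0-based coordinates, extended by 0 *)
Definition Rn_coord (x : Rn) (k : nat) : F := oapp (x 0) 0 (insub k : option 'I_n).

Lemma Rn_coordE (x : Rn) (k : 'I_n) : Rn_coord x k = x 0 k.
Proof. by rewrite /Rn_coord valK. Qed.

Lemma Rn_coord_inj (x y : Rn) :
  (forall k, (k < n)%N -> Rn_coord x k = Rn_coord y k) -> x = y.
Proof. by move=> xy; apply/rowP => k; rewrite -!Rn_coordE xy. Qed.

Lemma Rn_coord_pair (x y : Rn) (a b : nat) :
  \sum_(i < n) \sum_(j < n) x 0 i * y 0 j * ((val i == a) && (val j == b))%:R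
  = Rn_coord x a * Rn_coord y b.
Proof.
have coord_sum (z : Rn) c :
    Rn_coord z c = \sum_(i < n) z 0 i * (val i == c)%:R.
  rewrite /Rn_coord; case: insubP => [k _ <- | nlt] /=.
    rewrite (bigD1 k) //= eqxx mulr1 big1 ?addr0 // => i.
    by rewrite -val_eqE => /negPf /= ->; rewrite mulr0.
  rewrite big1 // => i _; case: eqP => [ic | _]; last by rewrite mulr0.
  by rewrite -ic ltn_ord in nlt.
rewrite !coord_sum mulr_suml; apply: eq_bigr => i _.
rewrite mulr_sumr; apply: eq_bigr => j _.
by rewrite -mulnb natrM mulrACA.
Qed.

Lemma Rn_table_coord (i j k : 'I_n) :
  Rn_table i.+1 j.+1 0 k =
    (2 <= k)%N%:R * (((val i == 0%N) && (val j == k.-1))%:R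
                     - ((val j == 0%N) && (val i == k.-1))%:R)
  + (4 <= k)%N%:R * (((val i == 1%N) && (val j == k.-2))%:R
                     - ((val j == 1%N) && (val i == k.-2))%:R).
Proof.
case: i j k => [i i_lt] [j j_lt] [k k_lt]; rewrite /Rn_table !addn1 !addn2 /=.
case: i j i_lt j_lt => [|[|i]] [|[|j]] i_lt j_lt /=;
  repeat (case: ifP => /=); rewrite ?mxE /= => *;
  case: k k_lt => [|[|[|[|k]]]] //= k_lt *;
  rewrite ?eqSS ?(mul0r, mul1r, subr0, sub0r, addr0, add0r, oppr0) //;
  rewrite ?oppr0 //.
all: try by (repeat case: eqP => ? //=; rewrite ?oppr0 //; lia).
Qed.

Lemma Rn_lie_coord (x y : Rn) (k : nat) : (k < n)%N ->
  Rn_coord (Rn_lie x y) k =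
    (2 <= k)%N%:R * (Rn_coord x 0 * Rn_coord y k.-1
                     - Rn_coord x k.-1 * Rn_coord y 0)
  + (4 <= k)%N%:R * (Rn_coord x 1 * Rn_coord y k.-2
                     - Rn_coord x k.-2 * Rn_coord y 1).
Proof.
move=> lt_kn; rewrite -[k]/(val (Ordinal lt_kn)); move: (Ordinal lt_kn) => {lt_kn}k.
rewrite Rn_coordE /Rn_lie summxE -!Rn_coord_pair !mulrBr !mulr_sumr.
rewrite -!sumrB -big_split; apply: eq_bigr => i _ /=.
rewrite summxE !mulr_sumr -!sumrB -big_split; apply: eq_bigr => j _ /=.
rewrite mxE Rn_table_coord !(andbC (val j == _)); ring.
Qed.

Lemma Rn_liexx x : Rn_lie x x = 0.
Proof.
apply: Rn_coord_inj => k lt_kn; rewrite Rn_lie_coord //.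
have -> : Rn_coord (0 : Rn) k = 0.
  by rewrite -[k]/(val (Ordinal lt_kn)) Rn_coordE mxE.
ring.
Qed.

Lemma Rn_lie_jacobi x y z :
  Rn_lie x (Rn_lie y z) + Rn_lie y (Rn_lie z x) + Rn_lie z (Rn_lie x y) = 0.
Proof.
have coordD (u v : Rn) k : (k < n)%N ->
    Rn_coord (u + v) k = Rn_coord u k + Rn_coord v k.
  by move=> lt_kn; rewrite -[k]/(val (Ordinal lt_kn)) !Rn_coordE mxE.
apply: Rn_coord_inj => k lt_kn; rewrite !coordD //.
have -> : Rn_coord (0 : Rn) k = 0.
  by rewrite -[k]/(val (Ordinal lt_kn)) Rn_coordE mxE.
rewrite ![Rn_coord (Rn_lie _ (Rn_lie _ _)) k]Rn_lie_coord //.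
have [n2 | n2] := ltnP n 2.
  have /andP[/negPf -> /negPf ->] : ~~ (2 <= k)%N && ~~ (4 <= k)%N by lia.
  by rewrite !mul0r !addr0.
have lie0 u v : Rn_coord (Rn_lie u v) 0 = 0 by rewrite Rn_lie_coord ?(ltnW n2) //= !mul0r addr0.
have lie1 u v : Rn_coord (Rn_lie u v) 1 = 0 by rewrite Rn_lie_coord //= !mul0r addr0.
have lt_k1 : (k.-1 < n)%N by lia.
have lt_k2 : (k.-2 < n)%N by lia.
rewrite !(lie0, lie1) ![Rn_coord (Rn_lie _ _) k.-1]Rn_lie_coord //.
rewrite ![Rn_coord (Rn_lie _ _) k.-2]Rn_lie_coord //.
by case: k {lt_kn lt_k1 lt_k2} => [|[|[|[|[|[|k]]]]]] /=; ring.
Qed.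

HB.instance Definition _ := isLieAlgebra.Build F Rn
  Rn_lie_linearl Rn_lie_linearr Rn_liexx Rn_lie_jacobi.

Definition Rn_tail (k : nat) : {vspace Rn} :=
  <<[seq Rn_e i | i <- iota k.+1 (n - k)]>>%VS.

Lemma Rn_coord_e (i k : nat) : (k < n)%N -> Rn_coord (Rn_e i) k = (k.+1 == i)%:R.
Proof.
by move=> lt_kn; rewrite -[k]/(val (Ordinal lt_kn)) Rn_coordE mxE.
Qed.

Lemma Rn_coord_span (a m k : nat) (x : Rn) : (k < n)%N -> (k.+1 < a)%N ->
  x \in <<[seq Rn_e i | i <- iota a m]>>%VS -> Rn_coord x k = 0.
Proof.
move=> lt_kn lt_ka /(@coord_span _ _ _ (in_tuple _)) ->.
rewrite -[k]/(val (Ordinal lt_kn)) Rn_coordE summxE big1 // => i _.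
have lt_im : (i < m)%N.
  by case: i => i /= lt_i; apply: leq_trans lt_i _; rewrite size_map size_iota.
rewrite mxE (nth_map 0%N) ?size_iota // nth_iota // mxE /=.
by rewrite (_ : (k.+1 == (a + i)%N) = false) ?mulr0 //; lia.
Qed.

Lemma Rn_tailP (k : nat) (x : Rn) : (k <= n)%N ->
  reflect (forall j, (j < k)%N -> Rn_coord x j = 0) (x \in Rn_tail k).
Proof.
move=> le_kn; apply: (iffP idP) => [xV j lt_jk | x0].
  by apply: Rn_coord_span xV; [exact: leq_trans le_kn | rewrite ltnS].
have -> : x = \sum_(i < n) x 0 i *: Rn_e i.+1.
  apply/rowP => j; rewrite summxE (bigD1 j) //= !mxE eqxx mulr1 big1 ?addr0 //.
  by move=> i; rewrite -val_eqE eq_sym => /negPf nij; rewrite !mxE eqSS nij mulr0.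
apply: rpred_sum => i _; have [lt_ik | le_ki] := ltnP i k.
  by rewrite -Rn_coordE x0 // scale0r mem0v.
rewrite memvZ // memv_span // map_f // mem_iota.
by have := ltn_ord i; lia.
Qed.

Lemma Rn_tail_dim (k : nat) : \dim (Rn_tail k) = (n - k)%N.
Proof.
suff free_e a m : (a + m <= n)%N -> free [seq Rn_e i | i <- iota a.+1 m].
  have [le_kn | lt_nk] := leqP k n; last first.
    have -> : (n - k = 0)%N by lia.
    by apply/eqP; rewrite -leqn0 (leq_trans (dim_span _)) // size_map size_iota; lia.
  by move/eqP: (free_e k (n - k)%N ltac:(lia)) => ->; rewrite size_map size_iota.
elim: m a => [|m IHm] a le_amn /=; first exact: nil_free.
rewrite free_cons IHm ?andbT; last by lia.
have lt_an : (a < n)%N by lia.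
apply/negP => /(Rn_coord_span lt_an (leqnn _)) /eqP.
by rewrite Rn_coord_e ?eqxx ?oner_eq0.
Qed.

Lemma Rn_lie_tail (U : {vspace Rn}) (k : nat) : (1 <= k < n)%N ->
  (forall y, y \in U -> forall x, Rn_lie x y \in Rn_tail k.+1) ->
  (forall i, (k < i < n)%N -> Rn_e i \in U) ->
  lie_prodv fullv U = Rn_tail k.+1.
Proof.
move=> k_gt sub sup; apply/eqP; rewrite eqEsubv; apply/andP; split.
  by apply/lie_prodvP => x y _ /sub; apply.
apply/span_subvP => v /mapP[i]; rewrite mem_iota => i_bd -> {v}.
have -> : Rn_e i = Rn_lie (Rn_e 1) (Rn_e i.-1).
  rewrite Rn_lie_e; [|by lia..]; rewrite /Rn_table eqxx.
  have -> /= : (2 <= i.-1 <= n - 1)%N by lia.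
  by congr Rn_e; lia.
have [_ sat] := @lie_prodvP _ _ fullv U (lie_prodv fullv U).
by apply: (sat (subvv _)); [exact: memvf | apply: sup; lia].
Qed.

Lemma Rn_filiform : filiform Rn.
Proof.
have dimR : \dim {:Rn} = n by rewrite dimvf; apply: mul1n.
rewrite /filiform dimR => i /andP[i_ge2 le_in]; rewrite -(Rn_tail_dim i).
congr (\dim _); elim: i i_ge2 le_in => [|[|i] IHi] // _ le_in.
rewrite /lower_central /= -/(lower_central _).
case: i IHi le_in => [|i] IHi le_in /=.
  apply: Rn_lie_tail => // [y _ x | j _]; last exact: memvf.
  apply/Rn_tailP => // j lt_j2; rewrite Rn_lie_coord; last by lia.
  by case: j lt_j2 => [|[|j]] //= _; rewrite !mul0r addr0.
have eL : iter i.+1 (lie_prodv fullv) fullv = Rn_tail i.+2 by apply: IHi; lia.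
rewrite -[lie_prodv _ (iter i _ _)]/(iter i.+1 (lie_prodv fullv) fullv) eL.
apply: Rn_lie_tail => [|y /Rn_tailP y0 x|j j_bd]; first by lia.
  apply/Rn_tailP => // j lt_j; rewrite Rn_lie_coord; last by lia.
  rewrite !y0 ?mulr0 ?subrr ?mulr0 ?addr0 //; lia.
by rewrite memv_span // map_f // mem_iota; lia.
Qed.

(* The matrix unit E_{i,j} *)
Definition gl_E (i j : nat) : gl F n :=
  \matrix_(k < n, l < n) ((k.+1 == i) && (l.+1 == j))%:R.

Definition psi_e (i : nat) : gl F n :=
  if i == 1%N then \sum_(1 <= k < n - 1) gl_E k (k + 1)
  else if i == 2%N then (\sum_(1 <= k < n - 2) gl_E k (k + 2)) + gl_E (n - 1) n
  else gl_E (n + 1 - i) n.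

Definition psi (a : Rn) : gl F n := \sum_(i < n) a 0 i *: psi_e i.+1.

End AlgebraR.

(* Main.v *)
(* Let W_i be the matrix of e_i in a representation of dimension m < n; the
   claim is that W_n = 0. The generalized eigenspaces of each W_k are stable
   under all W_i, because ad W_k is nilpotent on their span, so if some W_k has
   only proper generalized eigenspaces, induction on m applies to their sum.
   Otherwise every W_k is a scalar c_k plus a nilpotent matrix; c_k = 0 for
   k >= 3, as W_k is then a commutator and has trace zero. Subtracting the
   scalars changes no bracket, and Engel's argument gives a flag
   V = V_0 > V_1 > ... > V_m = 0 with V_i W_j <= V_(i+1). As
   W_(k+1) = [W_1, W_k], W_k shifts the flag by k - 1 steps if k >= 2, so W_n
   maps V_0 into V_(n-1) = 0. *)
Require Import Defs.
From mathcomp Require Import all_boot all_order all_algebra.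
From mathcomp Require Import complex.
From mathcomp Require Import reals.
From mathcomp Require Import ring zify.
From mathcomp Require Import boolp classical_sets.

Set Implicit Arguments.
Unset Strict Implicit.
Unset Printing Implicit Defensive.

Import GRing.Theory Num.Theory.
Local Open Scope ring_scope.

(** * Generalized eigenspaces over an algebraically closed field *)

Section GeneralizedEigenspaces.
Variables (F : closedFieldType) (m : nat).
Implicit Types (g : 'M[F]_m.+1) (a : F).

(** The kernels of the powers of [g - a%:M] stop growing at exponent [m.+1], because [a] has
    multiplicity at most [m.+1] in the characteristic polynomial. *)
Lemma geigenspace_quotient k (v : 'M[F]_(k, m.+1)) g a :
  (v *m (g - a%:M) <= geigenspace g a)%MS -> (v <= geigenspace g a)%MS.
Proof.
rewrite geigenspaceE => /sub_kermxP vgS; apply/sub_kermxP.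
have charN0 : char_poly g != 0 by rewrite monic_neq0 ?char_poly_monic.
have [r [q]] := multiplicity_XsubC (char_poly g) a.
rewrite charN0 /= -coprimep_XsubC => /Bezout_eq1_coprimepP[[u w] /= uw] charE.
have le_rm : (r <= m.+1)%N.
  have qN0 : q != 0 by apply: contraNneq charN0 => q0; rewrite charE q0 mul0r.
  rewrite -ltnS -[m.+2](size_char_poly g) charE size_proper_mul.
    rewrite size_exp_XsubC; move: qN0; rewrite -size_poly_gt0; lia.
  by rewrite lead_coef_exp lead_coefXsubC expr1n mulr1 lead_coef_eq0.
pose L := 'X - a%:P.
(* This is the Bezout relation between [q] and [L] times [L ^+ m.+1]; Cayley-Hamilton then kills the
   last term. *)
have LE : L ^+ m.+1 = L * L ^+ m.+1 * w + char_poly g * (u * L ^+ (m.+1 - r)).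
  rewrite charE -[in LHS](mulr1 (_ ^+ _)) -uw -/L.
  have -> : L ^+ m.+1 = L ^+ (r + (m.+1 - r)) by rewrite subnKC.
  by rewrite exprD; ring.
have hornL : horner_mx g L = g - a%:M by rewrite rmorphB /= horner_mx_X horner_mx_C.
have := congr1 (horner_mx g) LE.
rewrite rmorphD !rmorphM /= !rmorphXn /= hornL Cayley_Hamilton mul0r addr0 => ->.
by rewrite -!mulmxE !mulmxA vgS mul0mx.
Qed.

(** Expresses, through annihilation, that the generalized eigenspaces span the whole space. *)
Lemma geigenspace_span k g (Z : 'M[F]_(m.+1, k)) :
  (forall a, geigenspace g a *m Z = 0) -> Z = 0.
Proof.
move=> gZ; have [r charE] := closed_field_poly_normal (char_poly g).
rewrite (eqP (char_poly_monic g)) scale1r in charE.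
have sizer : size r = m.+1.
  by apply: succn_inj; rewrite -(size_char_poly g) charE size_prod_XsubC.
have dvd_char (p : {poly F}) s : {in s, forall z, ('X - z%:P) %| p} ->
    \prod_(z <- s) ('X - z%:P) %| p ^+ size s.
  elim: s => [|z s IHs] sp; first by rewrite big_nil dvd1p.
  rewrite big_cons exprS dvdp_mul ?sp ?mem_head ?IHs // => y ys.
  by rewrite sp // inE ys orbT.
(* Removing repeated roots makes the factors pairwise coprime, so that the kernel of a product is
   the sum of the kernels; the exponent [m.+1] makes up for the lost multiplicities. *)
pose p := \prod_(z <- undup r) ('X - z%:P) : {poly F}.
have cp : mxminpoly g %| p ^+ m.+1.
  apply: dvdp_trans (mxminpoly_dvd_char g) _; rewrite charE -sizer dvd_char //.
  by move=> z zr; rewrite dvdp_XsubCl root_prod_XsubC mem_undup.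
have kerZ s : uniq s ->
    kermxpoly g (\prod_(z <- s) ('X - z%:P) ^+ m.+1) *m Z = 0.
  elim: s => [|z s IHs] /=; first by rewrite big_nil kermxpoly1 mul0mx.
  case/andP=> zNs /IHs sZ; rewrite big_cons; apply/sub_kermxP.
  rewrite kermxpolyM; last first.
    rewrite prodrXl coprimep_expl ?coprimep_expr // coprimep_sym.
    by rewrite coprimep_XsubC root_prod_XsubC.
  by rewrite addsmx_sub; apply/andP; split; apply/sub_kermxP; rewrite ?sZ ?gZ.
have := kerZ _ (undup_uniq r); rewrite prodrXl => /sub_kermxP.
by rewrite kermxpoly_min // => /sub_kermxP; rewrite mul1mx.
Qed.

(** Here [g - a%:M] is nilpotent, so [a] is the only root of the characteristic polynomial, and the
    trace is the sum of the roots. *)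
Lemma geigenspace_full_trace g a :
  row_full (geigenspace g a) -> \tr g = a *+ m.+1.
Proof.
rewrite -sub1mx geigenspaceE => /sub_kermxP; rewrite mul1mx => nil_g.
have [r charE] := closed_field_poly_normal (char_poly g).
rewrite (eqP (char_poly_monic g)) scale1r in charE.
have sizer : size r = m.+1.
  by apply: succn_inj; rewrite -(size_char_poly g) charE size_prod_XsubC.
have ra : {in r, forall z, z = a}.
  move=> z; rewrite -root_prod_XsubC -charE -eigenvalue_root_char.
  case/eigenvalueP => v vg vN0; apply/eqP; rewrite -subr_eq0.
  have vgX i : v *m (g - a%:M) ^+ i = (z - a) ^+ i *: v.
    elim: i => [|i IHi]; first by rewrite !expr0 scale1r mulmx1.
    rewrite exprS -mulmxE mulmxA mulmxBr vg mul_mx_scalar -scalerBl -scalemxAl IHi.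
    by rewrite scalerA -exprS.
  have := vgX m.+1; rewrite nil_g mulmx0 => /esym/eqP.
  by rewrite scaler_eq0 (negPf vN0) orbF expf_eq0.
apply: oppr_inj; rewrite -char_poly_trace // charE.
have -> : m.+1.-1 = (size r).-1 by rewrite sizer.
rewrite coefPn_prod_XsubC ?sizer // big_seq.
rewrite (eq_bigr (fun=> a)) => [|z /ra //].
by rewrite -big_seq big_const_seq iter_addr_0 count_predT sizer.
Qed.

End GeneralizedEigenspaces.

(** * Families with the filiform relations: the nilpotent case *)

Section FiliformFamilies.
Variable F : fieldType.

(* With W i the image of e_(i+1), the indices being 0-based here, these are the
   relations of Rn that the lower bound on the dimension uses. *)
Definition filiform_family n m (W : nat -> 'M[F]_m) : Prop :=
  [/\ forall i, (n <= i)%N -> W i = 0,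
      forall i j, (i < j)%N -> exists a l,
        (j < l)%N /\ W i *m W j - W j *m W i = a *: W l
    & forall i, (0 < i)%N -> W i.+1 = W 0 *m W i - W i *m W 0].

Variables (n m : nat) (W : nat -> 'M[F]_m).
Hypothesis famW : filiform_family n W.

(** [U] grows by [V *m W k] for decreasing [k]. It stays stable because commutators with [W k] only
    involve later indices, and proper because [V = U + V *m W k] would give [V = U + V *m W k ^+ b]
    for every [b], against nilpotency. *)
Lemma family_engel (V : 'M[F]_m) :
    (forall i, exists k, W i ^+ k = 0) -> (forall i, stablemx V (W i)) ->
    V != 0 ->
  exists U : 'M[F]_m,
    [/\ (U < V)%MS, forall i, stablemx U (W i) & forall i, (V *m W i <= U)%MS].
Proof.
move=> nilW stV VN0; have [W0 comW _] := famW.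
suff: forall d, exists U : 'M[F]_m, [/\ (U < V)%MS, forall i, stablemx U (W i)
    & forall i, (n - d <= i)%N -> (V *m W i <= U)%MS].
  by move=> /(_ n)[U [ltU stU VU]]; exists U; split=> // i; rewrite VU ?subnn.
elim=> [|d [U [ltUV stU VU]]].
  exists 0; split=> [|i|i]; first by rewrite lt0mx.
    by rewrite mul0mx sub0mx.
  by rewrite subn0 => /W0 ->; rewrite mulmx0 sub0mx.
have [le_nd | lt_dn] := leqP n d.
  by exists U; split=> // i; rewrite VU //; lia.
set k := (n - d.+1)%N; have leUV := ltmxW ltUV.
have VWk : (U + V *m W k <= V)%MS by rewrite addsmx_sub leUV stV.
have VU' i : (k <= i)%N -> (V *m W i <= U + V *m W k)%MS.
  rewrite leq_eqVlt => /predU1P[<- | lt_ki]; first exact: addsmxSr.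
  by apply: submx_trans (addsmxSl _ _); rewrite VU //; rewrite /k in lt_ki; lia.
exists (U + V *m W k)%MS; split=> // [|i].
  rewrite ltmxE VWk; apply/negP => VWk'; case: (nilW k) => a Wka.
  suff VUW b : (V <= U + V *m W k ^+ b)%MS.
    have := VUW a; rewrite Wka mulmx0 addsmx0 => VU0.
    by move: ltUV; rewrite ltmxE VU0 andbF.
  elim: b => [|b IHb]; first by rewrite expr0 mulmx1 addsmxSr.
  apply: (submx_trans VWk'); rewrite addsmx_sub addsmxSl /=.
  apply: submx_trans (submxMr (W k) IHb) _; rewrite addsmxMr.
  by rewrite addsmxS ?stU // exprSr -mulmxE mulmxA.
have [le_ki | lt_ik] := leqP k i.
  by apply: submx_trans (VU' i le_ki); apply: submxMr.
rewrite addsmxMr addsmx_sub (submx_trans (stU i)) ?addsmxSl //=.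
have [a [l [lt_kl WE]]] := comW _ _ lt_ik.
have -> : V *m W k *m W i = V *m W i *m W k - a *: (V *m W l).
  by rewrite scalemxAr -WE mulmxBr !mulmxA subKr.
rewrite addmx_sub ?eqmx_opp ?scalemx_sub ?VU' ?(ltnW lt_kl) //.
by apply: submx_trans (addsmxSr _ _); rewrite submxMr.
Qed.

Lemma family_flag (V : 'M[F]_m) :
    (forall i, exists k, W i ^+ k = 0) -> (forall i, stablemx V (W i)) ->
  exists f : nat -> 'M[F]_m,
    [/\ f 0%N = V, forall i j, (f i *m W j <= f i.+1)%MS
      & forall i, (\rank V <= i)%N -> f i = 0].
Proof.
move=> nilW; have [r] := ubnP (\rank V); elim: r V => // r IHr V ltVr stV.
have [-> | VN0] := eqVneq V 0.
  by exists (fun=> 0); split=> // i j; rewrite mul0mx.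
have [U [ltUV stU VU]] := family_engel nilW stV VN0.
have ltr := rank_ltmx ltUV.
have [f [f0 fW fU]] := IHr U (leq_trans ltr ltVr) stU.
exists (fun i => if i is j.+1 then f j else V); split=> // [[|i] j|[|i] lt_i] //=.
- by rewrite f0.
- by apply/eqP; rewrite -mxrank_eq0 -leqn0.
- by apply: fU; rewrite -ltnS (leq_trans ltr).
Qed.

Lemma nilpotent_family_eq0 :
  (forall i, exists k, W i ^+ k = 0) -> (1 < n)%N -> (m < n)%N ->
  W n.-1 = 0.
Proof.
move=> nilW n_gt1 lt_mn; have [_ _ W0] := famW.
have [f [f0 fW fm]] := @family_flag 1%:M nilW (fun i => submx1 _).
(* With 0-based indices [W k] shifts the flag by [k]; [W 0] shifts it by 1, and so each commutator
   with [W 0] gains one step. *)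
have fWk k i : (0 < k)%N -> (f i *m W k <= f (i + k)%N)%MS.
  elim: k i => [|[|k] IHk] i // _; first by rewrite addn1 fW.
  rewrite W0 // mulmxBr !mulmxA addmx_sub ?eqmx_opp //.
    apply: submx_trans (submxMr _ (fW _ _)) _.
    by rewrite addnS -addSn IHk.
  apply: submx_trans (submxMr _ (IHk _ _)) _ => //.
  by rewrite [(i + k.+2)%N]addnS fW.
have := fWk n.-1 0%N; rewrite f0 mul1mx add0n fm ?mxrank1 ?submx0 => [H|].
  by apply/eqP/H; lia.
by lia.
Qed.

(** Restriction to a stable subspace with basis [V], as the induction on the dimension requires. *)
Lemma family_conj r (V : 'M[F]_(r, m)) :
    (forall i, stablemx V (W i)) -> row_free V ->
  filiform_family n (fun i => conjmx V (W i)).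
Proof.
move=> stV Vfree; have [W0 comW W0i] := famW.
have conjB A B : conjmx V (A - B) = conjmx V A - conjmx V B.
  by rewrite /conjmx mulmxBr mulmxBl.
split=> [i /W0 ->|i j|i i_gt0]; first exact: conjmx0.
  case/comW=> a [l [lt_jl WE]]; exists a, l; split=> //.
  rewrite -!conjmxM ?inE // -conjB WE.
  by rewrite /conjmx -scalemxAr -scalemxAl.
by rewrite -!conjmxM ?inE // -conjB W0i.
Qed.

End FiliformFamilies.

(** * Reduction of arbitrary families to nilpotent ones *)

Section LowerBound.
Variable F : closedFieldType.

(** Descending induction on [i]: the commutator of [W i] and [W k] is a multiple of some [W l] with
    [l > i], hence preserves [K]. An inner induction on the power of [W k - a%:M] that kills [v]
    puts [v *m W i *m (W k - a%:M)] in [K], and [geigenspace_quotient] concludes. *)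
Lemma family_geigenspace_stable n m (W : nat -> 'M[F]_m.+1) k a :
  filiform_family n W -> forall i, stablemx (geigenspace (W k) a) (W i).
Proof.
case=> W0 comW _; set K := geigenspace _ _.
suff: forall d i, (n - d <= i)%N -> stablemx K (W i).
  by move=> stK i; apply: (stK n); rewrite subnn.
elim=> [|d IHd] i lt_di; first by rewrite W0 ?mulmx0 ?sub0mx // -[n]subn0.
have stK v l : (v <= K)%MS -> (i < l)%N -> (v *m W l <= K)%MS.
  by move=> vK lt_il; apply: submx_trans (submxMr _ vK) (IHd l _); lia.
have comK (v : 'M_m.+1) :
    (v <= K)%MS -> (v *m (W i *m W k - W k *m W i) <= K)%MS.
  move=> vK; have [lt_ik | lt_ki | ->] := ltngtP i k; last first.
  - by rewrite subrr mulmx0 sub0mx.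
  - have [b [l [lt_il Wki]]] := comW _ _ lt_ki.
    by rewrite -opprB Wki -scaleNr -scalemxAr scalemx_sub // stK.
  have [b [l [lt_kl ->]]] := comW _ _ lt_ik.
  by rewrite -scalemxAr scalemx_sub // stK // (ltn_trans lt_ik).
suff stT b (v : 'M_m.+1) :
    (v <= K)%MS -> v *m (W k - a%:M) ^+ b = 0 -> (v *m W i <= K)%MS.
  apply: (stT m.+1) => //; rewrite /K geigenspaceE; exact: mulmx_ker.
elim: b v => [|b IHb] v vK.
  by rewrite expr0 mulmx1 => ->; rewrite mul0mx sub0mx.
rewrite exprS -mulmxE mulmxA => vTb; apply: geigenspace_quotient.
have -> : v *m W i *m (W k - a%:M) =
    v *m (W k - a%:M) *m W i + v *m (W i *m W k - W k *m W i).
  rewrite !mulmxBr mulmxBl !mul_mx_scalar -scalemxAl !mulmxA.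
  by rewrite [RHS]addrC addrA subrK.
rewrite addmx_sub ?comK // IHb //.
rewrite mulmxBr mul_mx_scalar addmx_sub ?eqmx_opp ?scalemx_sub //.
apply: submx_trans (submxMr _ vK) _.
exact: comm_mx_stable_geigenspace.
Qed.

(** Scalars leave commutators unchanged, and the right-hand sides of the relations have index at
    least 2, where nothing is subtracted. *)
Lemma family_shift n m (W : nat -> 'M[F]_m) (c : nat -> F) :
    filiform_family n W -> (1 < n)%N -> (forall i, (1 < i)%N -> c i = 0) ->
  filiform_family n (fun i => W i - (c i)%:M).
Proof.
case=> W0 comW W0i n_gt1 c0.
have WE i : (1 < i)%N -> W i - (c i)%:M = W i.
  by move/c0->; rewrite (raddf0 (@scalar_mx F m)) subr0.
have comS i j : (W i - (c i)%:M) *m (W j - (c j)%:M) -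
    (W j - (c j)%:M) *m (W i - (c i)%:M) = W i *m W j - W j *m W i.
  rewrite !mulmxBl !mulmxBr !mul_mx_scalar !mul_scalar_mx !scale_scalar_mx.
  by apply/matrixP => x y; rewrite !mxE; ring.
split=> [i le_ni|i j /[dup] lt_ij /comW[a [l [lt_jl Wij]]]|i i_gt0].
- by rewrite WE ?W0 // (leq_trans n_gt1).
- by exists a, l; rewrite comS WE //; lia.
- by rewrite comS WE // W0i.
Qed.

Lemma family_eq0 n m (W : nat -> 'M[F]_m) :
  [pchar F] =i pred0 -> (2 < n)%N -> (m < n)%N -> filiform_family n W ->
  W n.-1 = 0.
Proof.
move=> charF0 n_gt2; have n_gt1 := ltnW n_gt2; have [r] := ubnP m.
elim: r m W => // r IHr [|m] W lt_mr lt_mn famW; first exact: flatmx0.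
have [[k propK] | fullK] :=
  pselect (exists k, forall a, ~~ row_full (geigenspace (W k) a)).
  apply: (@geigenspace_span _ _ _ (W k)) => a; set K := geigenspace _ _.
  have stK i : stablemx (row_base K) (W i).
    by rewrite stablemx_row_base; apply: family_geigenspace_stable famW i.
  have lt_Km : (\rank K < m.+1)%N.
    by rewrite ltnNge col_leq_rank; apply: propK.
  have famK := family_conj famW stK (row_base_free K).
  have Z0 := IHr _ _ (leq_trans lt_Km lt_mr) (ltn_trans lt_Km lt_mn) famK.
  have KZ : row_base K *m W n.-1 = 0.
    (* By stability, [row_base K *m W n.-1] is the restricted matrix times [row_base K]. *)
    by rewrite -(mulmxKpV (stK n.-1)) [_ *m pinvmx _]Z0 mul0mx.
  by apply/sub_kermxP; rewrite -(eq_row_base K); apply/sub_kermxP.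
have /choice[c cK] k : exists a, row_full (geigenspace (W k) a).
  apply: contrapT => /forallNP nfull; apply: fullK; exists k => a.
  exact/negP/nfull.
have [_ _ W0i] := famW.
have c0 i : (1 < i)%N -> c i = 0.
  case: i => [|i] // /[1!ltnS] i_gt0; have := geigenspace_full_trace (cK i.+1).
  rewrite W0i // raddfB /= mxtrace_mulC subrr -mulr_natr => /esym/eqP.
  by rewrite mulf_eq0 ((pcharf0P F).1 charF0) orbF => /eqP.
have famS := family_shift famW n_gt1 c0.
have nilS i : exists k, (W i - (c i)%:M) ^+ k = 0.
  exists m.+1; have := cK i.
  by rewrite -sub1mx geigenspaceE => /sub_kermxP; rewrite mul1mx.
have := nilpotent_family_eq0 famS nilS n_gt1 lt_mn.
(* As [n > 2], the index [n.-1] exceeds 1, so no scalar was subtracted from [W n.-1]. *)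
by rewrite c0 ?(raddf0 (@scalar_mx F m.+1)) ?subr0 //; lia.
Qed.

End LowerBound.

(** * Representations of R_n as filiform families, and the representation [psi] *)

Section Rn.
Variables (F : fieldType) (n : nat).
Hypothesis n_gt2 : (2 < n)%N.

Lemma Rn_e_eq0 i : (n < i)%N -> Rn_e F n i = 0.
Proof.
move=> lt_ni; apply/rowP => k; rewrite !mxE.
by rewrite (_ : (k.+1 == i) = false) //; have := ltn_ord k; lia.
Qed.

Lemma representation_family m (rho : Rn F n -> gl F m) :
  representation rho -> filiform_family n (fun i => rho (Rn_e F n i.+1)).
Proof.
case=> lin_rho rhoM.
have rho0 : rho 0 = 0.
  by have := lin_rho (-1) 0 0; rewrite !scaleN1r !addNr.
have rho_table i j : (i < n)%N -> (j < n)%N ->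
    rho (Rn_e F n i.+1) *m rho (Rn_e F n j.+1) -
    rho (Rn_e F n j.+1) *m rho (Rn_e F n i.+1) = rho (Rn_table F n i.+1 j.+1).
  by move=> lt_in lt_jn; rewrite -Rn_lie_e // rhoM.
split=> [i le_ni|i j lt_ij|i i_gt0]; first by rewrite Rn_e_eq0.
  have [lt_jn | le_nj] := ltnP j n; last first.
    exists 0, j.+1; split=> //.
    by rewrite (@Rn_e_eq0 j.+1) // rho0 mulmx0 mul0mx subrr scale0r.
  rewrite rho_table //; last exact: ltn_trans lt_jn.
  rewrite /Rn_table; case: ifP => _.
    by exists 1, j.+1; rewrite scale1r addn1.
  rewrite ifN; last by lia.
  case: ifP => _.
    by exists 1, j.+2; rewrite scale1r addn2.
  rewrite ifN; last by lia.
  by exists 0, j.+1; rewrite rho0 scale0r.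
have [lt_in | le_ni] := ltnP i n; last first.
  by rewrite (@Rn_e_eq0 i.+2) ?(@Rn_e_eq0 i.+1) ?rho0 ?mulmx0 ?mul0mx ?subrr //; lia.
rewrite rho_table //; last by lia.
rewrite /Rn_table eqxx /=; case: ifP => [_|lt_in1]; first by rewrite addn1.
(* Here [i.+1 = n]: the bracket of e_1 and e_n is zero, in accordance with e_(n+1) = 0. *)
have -> : i.+1 == 1%N = false by lia.
have -> : (i.+1 == 2%N) && (2 < 1 <= n - 2)%N = false by lia.
by rewrite /= Rn_e_eq0 //; lia.
Qed.

(* 0-based entries, for any natural numbers k and l *)
Definition psi_coef (a : Rn F n) (k l : nat) : F :=
  if l == n.-1 then (k < n.-1)%N%:R * Rn_coord a (n.-1 - k)
  else (l == k.+1)%:R * Rn_coord a 0 + (l == k.+2)%:R * Rn_coord a 1.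

Lemma psiE (a : Rn F n) (k l : 'I_n) : psi a k l = psi_coef a k l.
Proof.
rewrite /psi_coef.
have sumE d : (\sum_(1 <= i < n - d) gl_E F n i (i + d)) k l =
    ((k.+1 < n - d)%N && (l == k + d :> nat)%N)%:R.
  rewrite summxE; have [lt_kd | le_dk] := ltnP k.+1 (n - d).
    rewrite (big_cat_nat _ (n := k.+1)) //=; last by apply: ltnW.
    rewrite (big_ltn lt_kd) big_nat big1 => [|i i_bd]; last first.
      by rewrite mxE (_ : (k.+1 == i) = false) //; lia.
    rewrite big_nat big1 => [|i i_bd]; last first.
      by rewrite mxE (_ : (k.+1 == i) = false) //; lia.
    by rewrite addr0 add0r mxE eqxx addSn eqSS.
  rewrite big_nat big1 // => i i_bd.
  by rewrite mxE (_ : (k.+1 == i) = false) //; lia.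
have lt0 : (0 < n)%N by lia.
have lt1 : (1 < n)%N by lia.
rewrite /psi summxE.
rewrite (bigD1 (Ordinal lt0)) //= (bigD1 (Ordinal lt1)) //=.
(* The later basis vectors only meet the last column: 0-based coordinate [i] sits in row [n.-1 - i],
   and [i >= 2] means a row below [n.-2]. *)
have -> : \sum_(i < n | (i != Ordinal lt0) && (i != Ordinal lt1))
    (a 0 i *: psi_e F n i.+1) k l =
  ((l == n.-1 :> nat) && (k < n.-2))%N%:R * Rn_coord a (n.-1 - k).
  have [lt_kn|le_nk] := ltnP k n.-2; last first.
    rewrite andbF mul0r big1 // => i; rewrite -!val_eqE /= => i_bd.
    have lt_in := ltn_ord i.
    rewrite mxE /psi_e !eqSS; rewrite ifN; last by lia.
    rewrite ifN; last by lia.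
    by rewrite mxE (_ : (k.+1 == _) = false) ?mulr0 //; lia.
  have lt_i : (n.-1 - k < n)%N by lia.
  rewrite (bigD1 (Ordinal lt_i)) /=; last by rewrite -!val_eqE /=; lia.
  rewrite big1 => [|i]; last first.
    rewrite -!val_eqE /= => i_bd.
    have lt_in := ltn_ord i.
    rewrite mxE /psi_e !eqSS; rewrite ifN; last by lia.
    rewrite ifN; last by lia.
    by rewrite mxE (_ : (k.+1 == _) = false) ?mulr0 //; lia.
  rewrite addr0 mxE /psi_e !eqSS ifN; last by lia.
  rewrite ifN; last by lia.
  rewrite mxE -[Rn_coord _ _]/(Rn_coord a (Ordinal lt_i)) Rn_coordE mulrC.
  by rewrite (_ : _ && (l.+1 == n) = (l == n.-1 :> nat) && true) //; lia.
rewrite !mxE /psi_e /= !sumE.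
rewrite -(Rn_coordE a (Ordinal lt0)) -(Rn_coordE a (Ordinal lt1)) /=.
have lt_ln := ltn_ord l; have lt_kn := ltn_ord k.
case: ifP => l_n.
  rewrite (_ : (k.+1 < n - 1) && _ = false)%N; last by lia.
  rewrite (_ : (k.+1 < n - 2) && _ = false)%N; last by lia.
  rewrite (_ : l.+1 == n); last by lia.
  (* In this row the last entry comes from the extra unit E_(n-1,n) of psi(e_2). *)
  have [kn2|] := eqVneq (k.+1) (n - 1)%N.
    have -> : (n.-1 - k = 1)%N by lia.
    have -> : (k < n.-1)%N by lia.
    have -> : (k < n.-2)%N = false by lia.
    by rewrite /= mulr0 !add0r mul0r addr0 mulrC.
  move=> kn2; have -> : (k < n.-2)%N = (k < n.-1)%N by lia.
  by rewrite /= mulr0 addr0 mulr0 !add0r.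
rewrite (_ : (l.+1 == n) = false); last by lia.
rewrite andbF mul0r addr0 addr0 addn1 addn2.
rewrite (_ : _ && (l == k.+1 :> nat) = (l == k.+1 :> nat)); last by lia.
rewrite (_ : _ && (l == k.+2 :> nat) = (l == k.+2 :> nat)); last by lia.
by rewrite ![_ * Rn_coord _ _]mulrC.
Qed.

(** Outside the last column, row [k] of [psi a] has entries only in columns [k.+1] and [k.+2]; the
    last column contributes nothing because the last row of [psi b] is zero. *)
Lemma psi_mulE (a b : Rn F n) (k l : 'I_n) : (psi a *m psi b) k l =
  (k.+1 < n.-1)%N%:R * (Rn_coord a 0 * psi_coef b k.+1 l)
  + (k.+2 < n.-1)%N%:R * (Rn_coord a 1 * psi_coef b k.+2 l).
Proof.
have lt_n1 : (n.-1 < n)%N by lia.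
have lt_ln := ltn_ord l.
have last_row : psi_coef b n.-1 l = 0.
  rewrite /psi_coef ltnn mul0r; case: ifP => // _.
  have -> : (l == n.-1.+1 :> nat) = false by lia.
  have -> : (l == n.-1.+2 :> nat) = false by lia.
  by rewrite !mul0r addr0.
have pick_row c (x : F) (G : nat -> F) : G n.-1 = 0 ->
    \sum_(j < n | j != Ordinal lt_n1) (j == c :> nat)%:R * x * G j =
    (c < n.-1)%N%:R * (x * G c).
  move=> G0; have [lt_cn | le_nc] := ltnP c n.-1; last first.
    rewrite mul0r big1 // => j; rewrite -val_eqE /= => jn; have lt_jn := ltn_ord j.
    by rewrite (_ : (j == c :> nat) = false) ?mul0r //; lia.
  have lt_c : (c < n)%N by lia.
  rewrite (bigD1 (Ordinal lt_c)) /=; last by rewrite -val_eqE /=; lia.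
  rewrite eqxx big1 ?addr0 ?mul1r // => j; rewrite -!val_eqE /= => /andP[_ /negPf->].
  by rewrite !mul0r.
rewrite mxE (bigD1 (Ordinal lt_n1)) //= [psi b _ _]psiE /= last_row mulr0 add0r.
rewrite -!(pick_row _ _ (fun j => psi_coef b j l)) // -big_split /=.
apply: eq_bigr => j; rewrite -val_eqE /= => jn.
by rewrite !psiE [psi_coef a k j]/psi_coef (negPf jn) mulrDl.
Qed.

Lemma psi_faithful : faithful_representation (@psi F n).
Proof.
have lin_psi : linear (@psi F n).
  move=> c x y; rewrite /psi scaler_sumr -big_split; apply: eq_bigr => i _.
  by rewrite !mxE scalerDl scalerA.
split; first split=> // x y.
  apply/matrixP => k l; rewrite psiE.
  have -> : lie (psi x) (psi y) k l =
      (psi x *m psi y) k l - (psi y *m psi x) k l by rewrite [LHS]mxE [X in _ + X = _]mxE.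
  have lt_kn := ltn_ord k; have lt_ln := ltn_ord l.
  have lie0 : Rn_coord (lie x y) 0 = 0.
    by rewrite [LHS]Rn_lie_coord ?mul0r ?addr0 //; lia.
  have lie1 : Rn_coord (lie x y) 1 = 0.
    by rewrite [LHS]Rn_lie_coord ?mul0r ?addr0 //; lia.
  rewrite !psi_mulE /psi_coef; case: ifP => l_n.
    have [c nE] : exists c, n = (k + c).+1 by exists (n - k.+1)%N; lia.
    have lt_c : (n.-1 - k < n)%N by lia.
    rewrite [Rn_coord (lie x y) _]Rn_lie_coord // {lie0 lie1}.
    have -> : (n.-1 - k = c)%N by lia.
    have -> : (n.-1 - k.+1 = c.-1)%N by lia.
    have -> : (n.-1 - k.+2 = c.-2)%N by lia.
    have -> : (k < n.-1)%N = (1 <= c)%N by lia.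
    have -> : (k.+1 < n.-1)%N = (2 <= c)%N by lia.
    have -> : (k.+2 < n.-1)%N = (3 <= c)%N by lia.
    by case: c {nE} => [|[|[|[|c]]]] /=; ring.
  rewrite lie0 lie1 !mulr0 addr0.
  (* Only on this diagonal do the two mixed products meet; they cancel once both indicators are
     known to be 1. *)
  have [lk|_] := eqVneq (l : nat) k.+3 => /=; last by ring.
  have -> : (k.+1 < n.-1)%N by lia.
  have -> : (k.+2 < n.-1)%N by lia.
  by ring.
(* The first coordinate is read off the entry (1,2), the others off the last column. *)
move=> x y xy; apply: Rn_coord_inj => -[_|i lt_in].
  have lt0 : (0 < n)%N by lia.
  have lt1 : (1 < n)%N by lia.
  have /matrixP/(_ (Ordinal lt0) (Ordinal lt1)) := xy.
  rewrite !psiE /psi_coef /= (_ : (1%N == n.-1) = false); last by lia.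
  by rewrite !mul1r !mul0r !addr0.
have lt_i : (n.-1 - i.+1 < n)%N by lia.
have lt_n : (n.-1 < n)%N by lia.
have /matrixP/(_ (Ordinal lt_i) (Ordinal lt_n)) := xy.
rewrite !psiE /psi_coef /= eqxx (_ : (_ < n.-1)%N); last by lia.
by rewrite !mul1r (_ : (n.-1 - (n.-1 - i.+1) = i.+1)%N) //; lia.
Qed.

End Rn.

(** * Minimality of the dimension n *)

Lemma faithful_dim_ge (F : closedFieldType) n m :
  [pchar F] =i pred0 -> (2 < n)%N -> faithful_dim (Rn F n) m -> (n <= m)%N.
Proof.
move=> charF0 n_gt2 [rho [rep_rho inj_rho]]; rewrite leqNgt; apply/negP => lt_mn.
have /= := family_eq0 charF0 n_gt2 lt_mn (representation_family n_gt2 rep_rho).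
have rho0 : rho 0 = 0.
  by have := rep_rho.1 (-1) 0 0; rewrite !scaleN1r !addNr.
rewrite -rho0 => /inj_rho/rowP lt_n.
have lt_n1 : (n.-1 < n)%N by lia.
have /eqP := lt_n (Ordinal lt_n1).
by rewrite !mxE eqxx oner_eq0.
Qed.

Theorem proposition3 (R : realType) (n : nat) (hn : (3 <= n)%N) :
  minimal_faithful_representation (@psi R[i]%C n).
Proof.
have psi_f := psi_faithful R[i]%C hn.
(* [mu] is chosen among the least faithful dimensions, so [n] must be shown to be one and the only
   one. *)
split=> //; apply/esym/xget_unique => [|m [[rho rho_f] m_min]].
  split=> [|m]; first by exists (@psi R[i]%C n).
  exact: faithful_dim_ge (pchar_num _) hn.
apply/eqP; rewrite eqn_leq m_min; last by exists (@psi R[i]%C n).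
by apply: faithful_dim_ge (pchar_num _) hn _; exists rho.
Qed.
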